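(* Let $X$ be a nonempty set, $\Omega\subseteq\mathcal P(X)$ an algebra, and $\mu$ a finite measure on $\Omega$. Then $\overline{\Omega}$, with the operations $\vee$, $\wedge$, ${}^{C}$ described in the context, is an algebra, and $\bar\mu$ is a measure on $\overline{\Omega}$ (it takes values in $[0,\infty)$, is subadditive, and is additive on disjoint pairs).
   Context: A sequence $\{B_n\}\subseteq\Omega$ is $\mu$-Cauchy if $\mu(B_n\triangle B_m)\to0$ as $n,m\to\infty$. $\overline{\Omega}$ is the set of equivalence classes $\overline{\{B_n\}}$ of $\mu$-Cauchy sequences, where $\{A_n\}$ and $\{B_n\}$ are equivalent iff $\lim_n\mu(A_n\triangle B_n)=0$. Operations: $\overline{\{A_n\}}\vee\overline{\{B_n\}}=\overline{\{A_n\cup B_n\}}$, $\overline{\{A_n\}}\wedge\overline{\{B_n\}}=\overline{\{A_n\cap B_n\}}$, $\overline{\{B_n\}}^{C}=\overline{\{B_n^{C}\}}$. $\bar\mu(\overline{\{B_n\}})=\lim_n\mu(B_n)$. $E_\phi$ denotes the class of the constant sequence $\emptyset$; $E,E'$ are disjoint if $E\wedge E'=E_\phi$. *)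

(* Defs.v *)
From HB Require Import structures.
From mathcomp Require Import all_boot all_order all_algebra generic_quotient.
From mathcomp Require Import all_classical all_reals all_analysis.

Set Implicit Arguments.
Unset Strict Implicit.
Unset Printing Implicit Defensive.

Import Order.TTheory GRing.Theory Num.Theory.
Import numFieldNormedType.Exports.

Local Open Scope classical_set_scope.
Local Open Scope ring_scope.
Local Open Scope ereal_scope.
Local Open Scope quotient_scope.

(* The algebra Omega is the family of [measurable] sets of an
   [algebraOfSetsType]; such a type is pointed, i.e. X is nonempty.
   "Measure" means finitely additive measure, i.e. [content]. *)
Section completion.
Context (d : measure_display) (X : algebraOfSetsType d) (R : realType).
Context (mu : {content set X -> \bar R}).

Definition mu_cauchy (B : nat -> set X) : Prop :=
  mu (B p.1 `+` B p.2) @[p --> (\oo, \oo)] --> 0.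

Record cauchy_seq := CauchySeq {
  cauchy_val :> nat -> set X;
  cauchy_measurable : forall n, measurable (cauchy_val n);
  cauchy_mu : mu_cauchy cauchy_val }.

HB.instance Definition _ := gen_eqMixin cauchy_seq.
HB.instance Definition _ := gen_choiceMixin cauchy_seq.

Definition cauchy_eqv (A B : cauchy_seq) : bool :=
  `[< mu (A n `+` B n) @[n --> \oo] --> 0 >].

Local Lemma measurable_setY (A B : set X) :
  measurable A -> measurable B -> measurable (A `+` B).
Proof.
by move=> mA mB; rewrite setY_def; apply: measurableU; apply: measurableD.
Qed.

Local Lemma content_le_setU (A B C : set X) : measurable A -> measurable B ->
  measurable C -> A `<=` B `|` C -> mu A <= mu B + mu C.
Proof.
move=> mA mB mC ABC; have mBC := measurableU _ _ mB mC.
apply: (@le_trans _ _ (mu (B `|` C))).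
  by apply: le_measure => //; rewrite inE.
have -> : B `|` C = B `|` (C `\` B) by rewrite setUDr setDv setD0.
rewrite measureU ?leeD2l//.
- by apply: le_measure; rewrite ?inE//; apply: measurableD.
- exact: measurableD.
- by rewrite setDE setICA setICr setI0.
Qed.

Local Lemma cvg0_le (I : Type) (F : set_system I) {FF : Filter F}
    (f g h : I -> \bar R) : (forall i, 0 <= h i <= f i + g i) ->
  f @ F --> 0 -> g @ F --> 0 -> h @ F --> 0.
Proof.
move=> hfg f0 g0; apply: (@squeeze_cvge _ _ _ _ (cst 0) h (f \+ g)).
- by apply: nearW => i; exact: hfg.
- exact: cvg_cst.
- by rewrite -[X in _ --> X]adde0; exact: cvgeD.
Qed.

Local Lemma cauchy_op (A B : cauchy_seq) (C : nat -> set X) :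
  (forall n, measurable (C n)) ->
  (forall n m, C n `+` C m `<=` (A n `+` A m) `|` (B n `+` B m)) ->
  mu_cauchy C.
Proof.
move=> mC CAB.
apply: (cvg0_le _ (cauchy_mu A) (cauchy_mu B)) => -[n m] /=.
rewrite measure_ge0/=; apply: content_le_setU => //;
  by apply: measurable_setY => //; apply: cauchy_measurable.
Qed.

Lemma cauchy_eqv_refl : reflexive cauchy_eqv.
Proof.
move=> A; apply/asboolP; under eq_fun do rewrite setYK measure0.
exact: cvg_cst.
Qed.

Lemma cauchy_eqv_sym : symmetric cauchy_eqv.
Proof.
by move=> A B; rewrite /cauchy_eqv; under eq_fun do rewrite setYC.
Qed.

Lemma cauchy_eqv_trans : transitive cauchy_eqv.
Proof.
move=> B A C /asboolP AB /asboolP BC; apply/asboolP.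
apply: (cvg0_le _ AB BC) => n /=; rewrite measure_ge0/=.
apply: content_le_setU.
1-3: by apply: measurable_setY; apply: cauchy_measurable.
move=> x; rewrite !setY_def /= /setD /setU /=.
by have := pselect (B n x); tauto.
Qed.

Canonical cauchy_equiv := EquivRel cauchy_eqv
  cauchy_eqv_refl cauchy_eqv_sym cauchy_eqv_trans.

Definition completion : Type := {eq_quot cauchy_equiv}.
HB.instance Definition _ := Choice.on completion.
HB.instance Definition _ := EqQuotient.on completion.

Definition cls (A : cauchy_seq) : completion := \pi_completion A.

Program Definition seqU (A B : cauchy_seq) : cauchy_seq :=
  @CauchySeq (fun n => A n `|` B n) _ _.
Next Obligation.
by move=> A B n; apply: measurableU; apply: cauchy_measurable.
Qed.
Next Obligation.
move=> A B; apply: (cauchy_op (A := A) (B := B)) => [n|n m x].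
  by apply: measurableU; apply: cauchy_measurable.
by rewrite !setY_def /= /setD /setU /=; tauto.
Qed.

Program Definition seqI (A B : cauchy_seq) : cauchy_seq :=
  @CauchySeq (fun n => A n `&` B n) _ _.
Next Obligation.
by move=> A B n; apply: measurableI; apply: cauchy_measurable.
Qed.
Next Obligation.
move=> A B; apply: (cauchy_op (A := A) (B := B)) => [n|n m x].
  by apply: measurableI; apply: cauchy_measurable.
rewrite !setY_def /= /setD /setU /setI /=.
have := pselect (B n x); have := pselect (A n x).
by have := pselect (B m x); have := pselect (A m x); tauto.
Qed.

Program Definition seqC (A : cauchy_seq) : cauchy_seq :=
  @CauchySeq (fun n => ~` A n) _ _.
Next Obligation.
by move=> A n; apply: measurableC; apply: cauchy_measurable.
Qed.
Next Obligation.
move=> A; apply: (cauchy_op (A := A) (B := A)) => [n|n m x].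
  by apply: measurableC; apply: cauchy_measurable.
rewrite !setY_def /= /setD /setU /setC /=.
by have := pselect (A n x); have := pselect (A m x); tauto.
Qed.

Program Definition seq_const (B : set X) (mB : measurable B) : cauchy_seq :=
  @CauchySeq (fun=> B) _ _.
Next Obligation. by []. Qed.
Next Obligation.
move=> B _; rewrite /mu_cauchy; under eq_fun do rewrite setYK measure0.
exact: cvg_cst.
Qed.

(* The operations use the representative picked by [repr], so that they are
   total functions; independence of the representative is not built in. *)
Definition joinc (E F : completion) : completion :=
  cls (seqU (repr E) (repr F)).
Definition meetc (E F : completion) : completion :=
  cls (seqI (repr E) (repr F)).
Definition complc (E : completion) : completion := cls (seqC (repr E)).
Definition botc : completion := cls (seq_const (@measurable0 _ X)).
Definition topc : completion := cls (seq_const (@measurableT _ X)).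
Definition mubar (E : completion) : \bar R :=
  lim (mu ((repr E : cauchy_seq) n) @[n --> \oo]).

End completion.

(* The lattice order is left free: it is determined by the operations. *)
Definition is_boolean_algebra (T : Type) (join meet : T -> T -> T)
    (compl : T -> T) (bot top : T) : Prop :=
  exists (disp : Order.disp_t) (c : Order.CTBDistrLattice.axioms_ disp T),
    let L := Order.CTBDistrLattice.Pack c in
    [/\ @Order.join disp L = join, @Order.meet disp L = meet,
        @Order.compl disp L = compl, @Order.bottom disp L = bot
      & @Order.top disp L = top].

(* Main.v *)
(* The symmetric difference of A op B and A' op B', for op a union or an
   intersection, lies in (A `+` A') `|` (B `+` B'), and that of complements is
   unchanged; so the operations descend to classes, where the laws of a Boolean
   algebra are inherited term by term from those of sets. Likewise
   |mu A - mu B| <= mu (A `+` B) makes mu converge along Cauchy sequences, to a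
   limit which depends on the class only. (Sub)additivity is the limit of
   mu (A `|` B) + mu (A `&` B) = mu A + mu B. *)
Require Import Defs.
From HB Require Import structures.
From mathcomp Require Import all_boot all_order all_algebra generic_quotient.
From mathcomp Require Import all_classical all_reals all_analysis.

Set Implicit Arguments.
Unset Strict Implicit.
Unset Printing Implicit Defensive.

Import Order.TTheory GRing.Theory Num.Theory.
Import numFieldNormedType.Exports.
Local Open Scope classical_set_scope.
Local Open Scope ring_scope.
Local Open Scope ereal_scope.

(** * The completion as a Boolean algebra *)

Section algebra.
Context (d : measure_display) (X : algebraOfSetsType d) (R : realType).
Context (mu : {content set X -> \bar R}).
Implicit Types (A B C : cauchy_seq mu) (E F G : completion mu).

Lemma cls_eqP A B : cls A = cls B <-> mu (A n `+` B n) @[n --> \oo] --> 0.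
Proof.
split=> [AB|AB].
  by apply/asboolP; apply/(@eqmodP _ (cauchy_equiv mu)).
by apply/(@eqmodP _ (cauchy_equiv mu)); apply/asboolP.
Qed.

Lemma cls_ext A B : (forall n, A n = B n) -> cls A = cls B.
Proof.
move=> AB; apply/cls_eqP.
by under eq_fun do rewrite AB setYK measure0; exact: cvg_cst.
Qed.

Lemma cls_repr E : cls (repr E) = E.
Proof. exact: reprK. Qed.

Let mY A B n : measurable (A n `+` B n).
Proof. by apply: Defs.measurable_setY; apply: cauchy_measurable. Qed.

(** By subadditivity, [mu (C n]+[C' n)] is squeezed between 0 and the sum of two null sequences.
    Leaving [C] and [C'] abstract lets one argument serve all three operations. *)
Lemma cls_congr2 A A' B B' C C' :
  cls A = cls A' -> cls B = cls B' ->
  (forall n, C n `+` C' n `<=` (A n `+` A' n) `|` (B n `+` B' n)) ->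
  cls C = cls C'.
Proof.
move=> /cls_eqP AA' /cls_eqP BB' CC'; apply/cls_eqP.
apply: (Defs.cvg0_le _ AA' BB') => n; rewrite measure_ge0/=.
exact: Defs.content_le_setU.
Qed.

(** Independence of the representatives: [A] and [repr (cls A)] have the same class, and likewise
    for [B], so congruence applies. *)
Lemma joinc_cls A B : joinc (cls A) (cls B) = cls (seqU A B).
Proof.
apply: (cls_congr2 (cls_repr (cls A)) (cls_repr (cls B))) => n x.
by rewrite !setY_def /= /setD /setU /=; tauto.
Qed.

Lemma meetc_cls A B : meetc (cls A) (cls B) = cls (seqI A B).
Proof.
apply: (cls_congr2 (cls_repr (cls A)) (cls_repr (cls B))) => n x.
rewrite !setY_def /= /setD /setU /setI /=.
have := pselect (B n x); have := pselect (A n x).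
have := pselect ((repr (cls A) : cauchy_seq mu) n x).
by have := pselect ((repr (cls B) : cauchy_seq mu) n x); tauto.
Qed.

Lemma complc_cls A : complc (cls A) = cls (seqC A).
Proof.
(* The operation is unary, so the same pair of representatives fills both slots. *)
apply: (cls_congr2 (cls_repr (cls A)) (cls_repr (cls A))) => n x.
rewrite !setY_def /= /setD /setU /setC /=.
have := pselect (A n x).
by have := pselect ((repr (cls A) : cauchy_seq mu) n x); tauto.
Qed.

Lemma joincC : commutative (@joinc _ _ _ mu).
Proof.
move=> E F; rewrite -(cls_repr E) -(cls_repr F) !joinc_cls.
by apply: cls_ext => n /=; rewrite setUC.
Qed.

Lemma meetcC : commutative (@meetc _ _ _ mu).
Proof.
move=> E F; rewrite -(cls_repr E) -(cls_repr F) !meetc_cls.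
by apply: cls_ext => n /=; rewrite setIC.
Qed.

Lemma joincA : associative (@joinc _ _ _ mu).
Proof.
move=> E F G; rewrite -(cls_repr E) -(cls_repr F) -(cls_repr G) !joinc_cls.
by apply: cls_ext => n /=; rewrite setUA.
Qed.

Lemma meetcA : associative (@meetc _ _ _ mu).
Proof.
move=> E F G; rewrite -(cls_repr E) -(cls_repr F) -(cls_repr G) !meetc_cls.
by apply: cls_ext => n /=; rewrite setIA.
Qed.

(** The order of the arguments is the one that the lattice factory expects. *)
Lemma joincKI F E : meetc E (joinc E F) = E.
Proof.
rewrite -(cls_repr E) -(cls_repr F) joinc_cls meetc_cls.
by apply: cls_ext => n /=; rewrite setUC setKU.
Qed.

Lemma meetcKU F E : joinc E (meetc E F) = E.
Proof.
rewrite -(cls_repr E) -(cls_repr F) meetc_cls joinc_cls.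
by apply: cls_ext => n /=; rewrite setIC setKI.
Qed.

Lemma meetcUl : left_distributive (@meetc _ _ _ mu) (@joinc _ _ _ mu).
Proof.
move=> E F G; rewrite -(cls_repr E) -(cls_repr F) -(cls_repr G).
rewrite joinc_cls !meetc_cls joinc_cls.
by apply: cls_ext => n /=; rewrite setIUl.
Qed.

Lemma meetcc : idempotent_op (@meetc _ _ _ mu).
Proof.
move=> E; rewrite -(cls_repr E) meetc_cls.
by apply: cls_ext => n /=; rewrite setIid.
Qed.

Lemma meetbotc E : meetc (botc mu) E = botc mu.
Proof.
rewrite -(cls_repr E) meetc_cls.
by apply: cls_ext => n /=; rewrite set0I.
Qed.

Lemma meetctop E : meetc E (topc mu) = E.
Proof.
rewrite -(cls_repr E) meetc_cls.
by apply: cls_ext => n /=; rewrite setIT.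
Qed.

Lemma joincCtop E : joinc E (complc E) = topc mu.
Proof.
rewrite -(cls_repr E) complc_cls joinc_cls.
by apply: cls_ext => n /=; rewrite setUv.
Qed.

Lemma meetcCbot E : meetc E (complc E) = botc mu.
Proof.
rewrite -(cls_repr E) complc_cls meetc_cls.
by apply: cls_ext => n /=; rewrite setICr.
Qed.

Fact completion_display : Order.disp_t. Proof. exact: (Order.Disp tt tt). Qed.

(** The order is read off from the meet, so that its two compatibility conditions hold by
    [erefl]. *)
HB.instance Definition _ :=
  @Order.isMeetJoinDistrLattice.Build completion_display (completion mu)
    (fun E F => meetc E F == E) (fun E F => (F != E) && (meetc E F == E))
    (@meetc _ _ _ mu) (@joinc _ _ _ mu) (fun _ _ => erefl) (fun _ _ => erefl)
    meetcC joincC meetcA joincA joincKI meetcKU meetcUl meetcc.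

Fact le_botc E : (botc mu <= E)%O.
Proof. by apply/eqP; exact: meetbotc. Qed.

Fact le_topc E : (E <= topc mu)%O.
Proof. by apply/eqP; exact: meetctop. Qed.

HB.instance Definition _ :=
  @Order.hasBottom.Build completion_display (completion mu) (botc mu) le_botc.

HB.instance Definition _ :=
  @Order.hasTop.Build completion_display (completion mu) (topc mu) le_topc.

HB.instance Definition _ :=
  @Order.TBDistrLattice_hasComplement.Build completion_display (completion mu)
    (@complc _ _ _ mu) joincCtop meetcCbot.

Lemma completion_is_boolean_algebra :
  is_boolean_algebra (@joinc d X R mu) (@meetc d X R mu) (@complc d X R mu)
    (botc mu) (topc mu).
Proof.
exists completion_display.
(* Repacking the inferred class yields the five operations by computation. *)
by exists (Order.CTBDistrLattice.class
  (completion mu : ctbDistrLatticeType completion_display)).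
Qed.

End algebra.

(** * The limit measure *)

Section measure.
Context (d : measure_display) (X : algebraOfSetsType d) (R : realType).
Context (mu : {content set X -> \bar R}) (mu_finite : fin_num_fun mu).
Implicit Types (A B : cauchy_seq mu) (E F : completion mu).

Local Notation m S := (fine (mu S)).

Let muE (S : set X) : measurable S -> mu S = (m S)%:E.
Proof. by move=> mS; rewrite fineK// mu_finite. Qed.

(** Each set lies in the union of the other with the symmetric difference; subadditivity gives one
    half of the bound and symmetry the other. *)
Lemma content_distY (S T : set X) : measurable S -> measurable T ->
  (`|m S - m T| <= m (S `+` T))%R.
Proof.
have half U V : measurable U -> measurable V ->
    (m U <= m V + m (U `+` V))%R.
  move=> mU mV; have mUV := Defs.measurable_setY mU mV.
  rewrite -lee_fin EFinD -!muE//.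
  apply: Defs.content_le_setU => // x; rewrite setY_def /setD /setU /=.
  by have := pselect (V x); tauto.
by move=> mS mT; rewrite ler_distl half// andbT lerBlDr setYC half.
Qed.

Let mA A n : measurable (A n). Proof. exact: cauchy_measurable. Qed.

(** Completeness of [R]: by [content_distY] the real values form a Cauchy sequence. *)
Lemma is_cvg_fine_content A : cvg (m (A n) @[n --> \oo]).
Proof.
apply: cauchy_cvg; apply: cauchy_exP => e e0.
have /fine_cvgP[_ /cvgrPdist_lt /(_ _ e0) [[P Q] [[N _ NP] [M _ MQ]] PQ]] :=
  cauchy_mu A.
(* The centre of the ball is the value at an index at least [N]. With the first index frozen there,
   the double limit controls the distance to every term from [M] on. *)
exists (m (A (maxn N M))); exists M => // n /= Mn.
have := PQ (maxn N M, n); rewrite /= sub0r normrN => PQn.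
rewrite /ball /=; apply: le_lt_trans (content_distY (mA _ _) (mA _ _)) _.
apply: le_lt_trans (ler_norm _) (PQn _); split => /=.
  by apply: NP; rewrite /= leq_maxl.
exact: MQ.
Qed.

(** The difference of the two real sequences is bounded by [m (A n]+[B n)], which tends to 0. *)
Lemma cls_fine_cvg A B (l : R) : cls A = cls B ->
  m (B n) @[n --> \oo] --> l -> m (A n) @[n --> \oo] --> l.
Proof.
move=> /cls_eqP AB Bl; apply: cvg_sub0 Bl.
apply/cvgr0Pnorm_lt => e e0.
have /fine_cvgP[_ /cvgrPdist_lt /(_ _ e0)] := AB.
apply: filterS => n; rewrite /= sub0r normrN => H.
apply: le_lt_trans (content_distY (mA _ _) (mA _ _)) _.
exact: le_lt_trans (ler_norm _) H.
Qed.

(** Since [mubar] is a bare [lim] along [repr (cls A)], existence of that limit has to be shown; it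
    is then carried over to [A]. A real [l] yields finiteness at the same time. *)
Let mubar_cvg_fin A :
  exists2 l : R, mubar (cls A) = l%:E & mu (A n) @[n --> \oo] --> l%:E.
Proof.
have cvgE B (l : R) :
    m (B n) @[n --> \oo] --> l -> mu (B n) @[n --> \oo] --> l%:E.
  move=> Bl; apply/fine_cvgP; split=> //.
  by apply: nearW => n; exact: mu_finite.
pose r : cauchy_seq mu := repr (cls A).
have rl := @is_cvg_fine_content r.
exists (lim (m (r n) @[n --> \oo])).
  by apply/cvg_lim => //; exact: cvgE.
by apply: cvgE; apply: cls_fine_cvg rl; rewrite cls_repr.
Qed.

Lemma mubar_cvg A : mu (A n) @[n --> \oo] --> mubar (cls A).
Proof. by have [l ->] := mubar_cvg_fin A. Qed.

Lemma mubar_fin_num E : mubar E \is a fin_num.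
Proof. by rewrite -(cls_repr E); have [l ->] := mubar_cvg_fin (repr E). Qed.

Lemma mubar_ge0 E : 0 <= mubar E.
Proof.
rewrite -(cls_repr E); have El := @mubar_cvg (repr E).
rewrite -(cvg_lim _ El)//; apply: lime_ge.
  by apply/cvg_ex; exists (mubar (cls (repr E))).
by apply: nearW => n; exact: measure_ge0.
Qed.

Lemma mubar_bot : mubar (botc mu) = 0.
Proof.
have := @mubar_cvg (seq_const mu measurable0).
move=> /cvg_lim <- //=; under eq_fun do rewrite measure0.
exact: lim_cst.
Qed.

(** This modular identity gives both remaining properties: dropping the nonnegative meet term yields
    subadditivity, and a null meet yields additivity. *)
Lemma mubarUI E F :
  mubar (joinc E F) + mubar (meetc E F) = mubar E + mubar F.
Proof.
rewrite -(cls_repr E) -(cls_repr F) joinc_cls meetc_cls.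
set A := repr E; set B := repr F.
(* Finite limits exclude sums of opposite infinities, as [cvgeD] demands. *)
have addd (G H : completion mu) : mubar G +? mubar H.
  by apply: fin_num_adde_defl; exact: mubar_fin_num.
have UI : mu (A n `|` B n) + mu (A n `&` B n) @[n --> \oo] -->
    mubar (cls (seqU A B)) + mubar (cls (seqI A B)).
  exact: cvgeD (@mubar_cvg (seqU A B)) (@mubar_cvg (seqI A B)).
have AB : mu (A n) + mu (B n) @[n --> \oo] --> mubar (cls A) + mubar (cls B).
  exact: cvgeD (@mubar_cvg A) (@mubar_cvg B).
rewrite -(cvg_lim _ UI)// -(cvg_lim _ AB)//.
suff -> : (fun n => mu (A n `|` B n) + mu (A n `&` B n)) =
    (fun n => mu (A n) + mu (B n)) by [].
apply/funext => n.
(* Split [B n] along [A n]; the part outside [A n] is then glued to [A n] to form the union. *)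
rewrite [mu (B n)](measureDI mu (mA _ _) (mA A n)) addeA.
rewrite -(measureU mu (mA A n) _ (setDIK _ _)); last exact: measurableD.
by rewrite setUDr setDv setD0 [B n `&` _]setIC.
Qed.

Lemma mubar_joinc_le E F : mubar (joinc E F) <= mubar E + mubar F.
Proof. by rewrite -mubarUI leeDl// mubar_ge0. Qed.

Lemma mubar_joinc_disjoint E F : meetc E F = botc mu ->
  mubar (joinc E F) = mubar E + mubar F.
Proof. by move=> EF; rewrite -mubarUI EF mubar_bot adde0. Qed.

End measure.

(** The operations and [mubar] are defined through [repr], so the clauses on [cls] record that any
    representative may be used; the convergence clause also states that the limit exists. *)
Theorem theorem1 (d : measure_display) (X : algebraOfSetsType d)
    (R : realType) (mu : {content set X -> \bar R})
    (mu_finite : fin_num_fun mu) :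
  [/\ (forall A B : cauchy_seq mu,
         joinc (cls A) (cls B) = cls (seqU A B)),
      (forall A B : cauchy_seq mu,
         meetc (cls A) (cls B) = cls (seqI A B)),
      (forall A : cauchy_seq mu, complc (cls A) = cls (seqC A))
    & is_boolean_algebra (@joinc d X R mu) (@meetc d X R mu)
        (@complc d X R mu) (botc mu) (topc mu)] /\
  [/\ (forall A : cauchy_seq mu, mu (A n) @[n --> \oo] --> mubar (cls A)),
      (forall E : completion mu, 0 <= mubar E < +oo),
      (forall E F : completion mu, mubar (joinc E F) <= mubar E + mubar F)
    & (forall E F : completion mu, meetc E F = botc mu ->
         mubar (joinc E F) = mubar E + mubar F)].
Proof.
split; split.
- exact: joinc_cls.
- exact: meetc_cls.
- exact: complc_cls.
- exact: completion_is_boolean_algebra.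
- exact: mubar_cvg.
- by move=> E; rewrite mubar_ge0// ltey_eq mubar_fin_num.
- exact: mubar_joinc_le.
- exact: mubar_joinc_disjoint.
Qed.
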